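(* Let $(T,f)$ be a countable tree of height $\le\omega$ in the predecessor framework. Then $(T,f)$ is weakly ultrahomogeneous if and only if there is a finite subtree $S$ of $T$ such that, for every $x\in S$, $T_S[x]$ is ultrahomogeneous (in the predecessor framework).
   Context: A tree $(T,f)$ in the predecessor formulation is a set $T$ with a root $\epsilon\in T$ and a unary function $f:T\to T$ such that $f(\epsilon)=\epsilon$ and every $a\in T$ satisfies $f^n(a)=\epsilon$ for some $n\in\omega$, $\epsilon$ being the only element $a$ with $f^m(a)=a$ for some $m\ge1$. The immediate successors of $a$ are the elements $b\ne\epsilon$ with $f(b)=a$. Write $a\prec b$ if $a\ne b$ and $a=f^m(b)$ for some $m\geq 1$; $b$ extends $a$ if $a\preceq b$. A subtree of $T$ is a subset containing $\epsilon$ and closed under $f$. For a subtree $S$ of $T$ and $x\in S$, $T_S[x]$ is the subtree of $T$ (with the restriction of $f$) consisting of $x$, all its predecessors (all $y\prec x$), and all nodes of $T$ which extend some immediate successor of $x$ that is not in $S$. The structure $(T,f)$ has language the single unary function symbol $f$. It is ultrahomogeneous if every isomorphism between finitely generated substructures (finite subsets closed under $f$) extends to an automorphism; it is weakly ultrahomogeneous if there is a finite set $\{a_1,\dots,a_n\}\subseteq T$ such that every isomorphism between finitely generated substructures containing all $a_i$ and fixing each $a_i$ extends to an automorphism of $(T,f)$. *)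

(* Defs.v *)
From mathcomp Require Import all_boot.
From mathcomp Require Import boolp classical_sets functions cardinality.

Set Implicit Arguments.
Unset Strict Implicit.
Unset Printing Implicit Defensive.

Local Open Scope classical_set_scope.

(* The second field is what bounds the height by omega: every node lies at a
   finite level. *)
Record is_tree (T : Type) (e : T) (f : T -> T) : Prop := IsTree {
  tree_root : f e = e;
  tree_reach : forall a, exists n, iter n f a = e;
  tree_acyclic : forall a, (exists m, iter m.+1 f a = a) -> a = e }.

Definition imm_succ (T : Type) (e : T) (f : T -> T) (a b : T) : Prop :=
  b <> e /\ f b = a.

Definition prec (T : Type) (f : T -> T) (a b : T) : Prop :=
  a <> b /\ exists m, a = iter m.+1 f b.

Definition extends (T : Type) (f : T -> T) (b a : T) : Prop :=
  a = b \/ prec f a b.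

Definition closed_under (T : Type) (f : T -> T) (A : set T) : Prop :=
  forall a, A a -> A (f a).

Definition is_subtree (T : Type) (e : T) (f : T -> T) (A : set T) : Prop :=
  A e /\ closed_under f A.

(* As f-orbits in a tree are finite, the finitely generated substructures are
   the finite closed subsets. *)
Definition fg_substructure (T : Type) (f : T -> T) (A : set T) : Prop :=
  finite_set A /\ closed_under f A.

(* Only the values of phi on A matter. *)
Definition sub_iso (T : Type) (f : T -> T) (A B : set T) (phi : T -> T) :
    Prop :=
  set_bij A B phi /\ forall a, A a -> phi (f a) = f (phi a).

Definition automorphism (T : Type) (f g : T -> T) : Prop :=
  bijective g /\ forall a, g (f a) = f (g a).

Definition extends_to_aut (T : Type) (f : T -> T) (A : set T)
    (phi : T -> T) : Prop :=
  exists2 g, automorphism f g & forall a, A a -> g a = phi a.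

Definition ultrahomogeneous (T : Type) (f : T -> T) : Prop :=
  forall (A B : set T) (phi : T -> T),
    fg_substructure f A -> fg_substructure f B -> sub_iso f A B phi ->
    extends_to_aut f A phi.

Definition weakly_ultrahomogeneous (T : Type) (f : T -> T) : Prop :=
  exists2 F : set T, finite_set F &
    forall (A B : set T) (phi : T -> T),
      fg_substructure f A -> fg_substructure f B ->
      F `<=` A -> F `<=` B ->
      sub_iso f A B phi -> (forall a, F a -> phi a = a) ->
      extends_to_aut f A phi.

Definition TS (T : Type) (e : T) (f : T -> T) (S : set T) (x : T) : set T :=
  [set y | [\/ y = x, prec f y x |
    exists b, [/\ imm_succ e f x b, ~ S b & extends f y b]]].

Lemma closed_mem (T : Type) (f : T -> T) (A : set T) (fA : closed_under f A)
  (u : A) : f (val u) \in A.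
Proof. by apply/mem_set/fA/set_mem; exact: valP. Qed.

Definition restr_fun (T : Type) (f : T -> T) (A : set T)
    (fA : closed_under f A) (u : A) : A :=
  SigSub (closed_mem fA u).

Lemma extends_pred (T : Type) (f : T -> T) (a : T) : extends f a (f a).
Proof.
have [->|ne] := pselect (f a = a); first by left.
by right; split=> //; exists 0.
Qed.

Lemma TS_closed (T : Type) (e : T) (f : T -> T) (S : set T) (x : T) :
  closed_under f (TS e f S x).
Proof.
have down y : extends f x y -> TS e f S x y.
  by case=> [->|yx]; [constructor 1|constructor 2].
move=> y [->|[_ [m ->]]|[b [xb nSb [<-|[nby [m bE]]]]]].
- exact/down/extends_pred.
- apply: down; rewrite -iterS.
  have [->|ne] := pselect (iter m.+2 f x = x); first by left.
  by right; split=> //; exists m.+1.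
- by case: xb => _ ->; constructor 1.
- constructor 3; exists b; split=> //.
  have [->|ne] := pselect (b = f y); first by left.
  right; split=> //; case: m bE => [//|m] bE.
  by exists m; rewrite bE [LHS]iterSr.
Qed.

Lemma TS_subtree (T : Type) (e : T) (f : T -> T) (S : set T) (x : T) :
  is_tree e f -> is_subtree e f (TS e f S x).
Proof.
move=> tT; split; last exact: TS_closed.
have [-> |nex] := pselect (e = x); first by constructor 1.
constructor 2; split=> //.
have [[|m] xe] := tree_reach tT x; first by case: nex.
by exists m.
Qed.

Definition TS_pred (T : Type) (e : T) (f : T -> T) (S : set T) (x : T) :
    TS e f S x -> TS e f S x :=
  restr_fun (@TS_closed T e f S x).

(* Main.v *)
Require Import Defs.
From mathcomp Require Import all_boot.
From mathcomp Require Import boolp classical_sets functions cardinality.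

Set Implicit Arguments.
Unset Strict Implicit.
Unset Printing Implicit Defensive.

Local Open Scope classical_set_scope.

(** The proof is a restriction-and-gluing argument, without any counting of
successors. Fix a finite subtree [S]. Climbing down from a node until [S] is
met attaches every node of [T] to exactly one node of [S], so [T] is the
disjoint union of the fibres of this retraction, and [TS e f S x] is the fibre
over [x] together with the branch from the root to [x], which lies in [S]
([TSP], [attached_inj], [attached_exists]). A map that commutes with [f],
fixes [S] pointwise and sends no other node into [S] preserves every fibre
([attached_morph]).

From weak ultrahomogeneity, take for [S] the subtree generated by the
parameters. An isomorphism [phi] between finite substructures of [TS e f S x]
preserves the height of nodes. Since [TS e f S x] has only one node at each
height up to that of [x], [phi] is the identity on its part in [S], and so
[phi] and the identity of [S] together form an isomorphism of finite
substructures of [T] ([sub_iso_TS_setU]). The automorphism of [T] extending it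
fixes [S], hence restricts to [TS e f S x].

Conversely, the nodes of [S] serve as parameters. A partial isomorphism that
fixes [S] restricts to each [TS e f S x] ([sub_iso_TS]), where it extends to an
automorphism [h x] ([TS_extension]). Distinct [TS e f S x] meet only in [S],
where each [h x] is the identity, so the [h x] glue to an automorphism of [T]
([glue_automorphism]). *)

(** * The retraction of a tree onto a subtree *)

(** For [S] a subtree and [x] in [S], this is the fibre over [x] of the
retraction sending a node to its greatest predecessor in [S]. The inductive
form, one step of [f] at a time, makes the compatibility with maps commuting
with [f] an immediate induction. *)
Inductive attached (T : Type) (f : T -> T) (S : set T) (x : T) : T -> Prop :=
| attached_base : attached f S x x
| attached_step y : ~ S y -> attached f S x (f y) -> attached f S x y.

Lemma attached_mem (T : Type) (f : T -> T) (S : set T) (x y : T) :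
  attached f S x y -> S y -> y = x.
Proof. by case. Qed.

Lemma attached_fun (T : Type) (f : T -> T) (S : set T) (x y : T) :
  S x -> attached f S x y -> ~ S y -> attached f S x (f y).
Proof. by move=> Sx; case. Qed.

Lemma attached_inj (T : Type) (f : T -> T) (S : set T) (x x' y : T) :
  S x -> S x' -> attached f S x y -> attached f S x' y -> x = x'.
Proof.
move=> Sx Sx'; elim=> [xx'|{}y nSy _ IH y'].
  exact: (attached_mem xx').
exact/IH/attached_fun.
Qed.

Lemma attached_exists (T : Type) (e : T) (f : T -> T) (S : set T) (y : T) :
  is_tree e f -> is_subtree e f S -> exists2 x, S x & attached f S x y.
Proof.
move=> tT [Se _]; have [n] := tree_reach tT y.
elim: n y => [y /= ->|n IH y]; first by exists e => //; exact: attached_base.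
rewrite iterSr => /IH[x Sx xy].
have [Sy|nSy] := pselect (S y); first by exists y => //; exact: attached_base.
by exists x => //; exact: attached_step.
Qed.

Lemma attached_iter (T : Type) (f : T -> T) (S : set T) (x y : T) :
  attached f S x y -> exists n, iter n f y = x.
Proof.
elim=> [|{}y _ _ [n nyx]]; first by exists 0.
by exists n.+1; rewrite iterSr.
Qed.

Lemma closed_under_iter (T : Type) (f : T -> T) (A : set T) n (a : T) :
  closed_under f A -> A a -> A (iter n f a).
Proof. by move=> fA Aa; elim: n => //= n /fA. Qed.

Lemma extendsP (T : Type) (f : T -> T) (a b : T) :
  extends f b a <-> exists n, a = iter n f b.
Proof.
split=> [[->|[_ [n ->]]]|[[|n] ->]]; first by exists 0.
- by exists n.+1.
- by left.
- have [->|ne] := pselect (iter n.+1 f b = b); first by left.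
  by right; split=> //; exists n.
Qed.

(** This replaces the definition of [TS] by the decomposition into the branch
below [x] and the fibre over [x]. The successor [b] of [x] in that definition
is the last node outside [S] met when climbing down to [x]. *)
Lemma TSP (T : Type) (e : T) (f : T -> T) (S : set T) (x y : T) :
  is_subtree e f S -> S x ->
  TS e f S x y <-> extends f x y \/ attached f S x y.
Proof.
move=> [Se fS] Sx; split.
  case=> [->|yx|[b [[_ fb] nSb /extendsP[n bE]]]].
  - by left; left.
  - by left; right.
  right; elim: n y bE => [y bE|n IH y].
    move: bE => /= bE; apply: attached_step; rewrite -bE // fb.
    exact: attached_base.
  move=> bE; apply: attached_step; last by apply: IH; rewrite -iterSr.
  by move=> Sy; apply: nSb; rewrite bE; exact: closed_under_iter.
case=> [[->|yx]|]; [by constructor 1|by constructor 2|].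
elim=> [|{}y nSy xfy IH]; first by constructor 1.
have [fyx|fyx] := pselect (f y = x).
  constructor 3; exists y; split=> //; last by left.
  by split=> // ye; apply: nSy; rewrite ye.
have nSfy : ~ S (f y) by move=> /(attached_mem xfy).
case: IH => [//|[_ [n fyE]]|[b [xb nSb /extendsP[n bE]]]].
  by case: nSfy; rewrite fyE; exact: closed_under_iter.
constructor 3; exists b; split=> //; apply/extendsP; exists n.+1.
by rewrite iterSr.
Qed.

Lemma attached_TS (T : Type) (e : T) (f : T -> T) (S : set T) (x y : T) :
  is_subtree e f S -> S x -> attached f S x y -> TS e f S x y.
Proof. by move=> tS Sx xy; apply/TSP => //; right. Qed.

(** The relation to [S] is needed in both directions: [h] fixes the end point
[x] of the climb down, and it keeps the earlier nodes outside [S], so the climb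
down from [h y] cannot stop before [x]. The set [A] is there to cover both
partial isomorphisms and automorphisms. *)
Lemma attached_morph (T : Type) (f : T -> T) (S A : set T) (h : T -> T)
    (x y : T) :
  closed_under f A ->
  (forall a, A a -> attached f S x a -> ~ S a -> h (f a) = f (h a)) ->
  h x = x ->
  (forall a, A a -> attached f S x a -> S (h a) -> S a) ->
  A y -> attached f S x y -> attached f S x (h y).
Proof.
move=> fA hf hx Sh Ay xy; elim: xy Ay => [_|{}y nSy xfy IH Ay].
  by rewrite hx; exact: attached_base.
have xy : attached f S x y by exact: attached_step.
apply: attached_step; first by move/(Sh _ Ay xy).
by rewrite -hf //; apply/IH/fA.
Qed.

(** * Rigidity of the branch below a node of the subtree *)

Lemma iter_root (T : Type) (e : T) (f : T -> T) n :
  is_tree e f -> iter n f e = e.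
Proof. by move=> tT; elim: n => //= n ->; exact: tree_root tT. Qed.

(** The root is the only fixed point of [f], so [phi] fixes it; injectivity then
shows that [phi] preserves the number of steps needed to reach it. Heights are
compared through the equations [iter n f a = e], which avoids choosing a least
such [n]. *)
Lemma sub_iso_level (T : Type) (e : T) (f : T -> T) (A B : set T)
    (phi : T -> T) n a :
  is_tree e f -> closed_under f A -> sub_iso f A B phi -> A a ->
  iter n f (phi a) = e <-> iter n f a = e.
Proof.
move=> tT fA [[_ phi_inj _] phif] Aa.
have phi_iter k : iter k f (phi a) = phi (iter k f a).
  by elim: k => //= k ->; rewrite phif //; exact: closed_under_iter.
have Ae : A e.
  by have [k <-] := tree_reach tT a; exact: closed_under_iter.
have phie : phi e = e.
  by apply: (tree_acyclic tT); exists 0; rewrite /= -phif // (tree_root tT).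
rewrite phi_iter; split=> [pe|->//].
apply: phi_inj; rewrite ?inE ?pe ?phie //.
exact: closed_under_iter.
Qed.

(** A proper predecessor of [z] reaches the root in fewer steps than [z]
does. *)
Lemma extends_level_eq (T : Type) (e : T) (f : T -> T) (y z : T) :
  is_tree e f -> extends f z y ->
  (forall n, iter n f y = e -> iter n f z = e) -> y = z.
Proof.
move=> tT /extendsP[[//|d] yE] lev.
have [n] := tree_reach tT z; elim: n => [/= ze|n IH nz].
  by rewrite yE ze iter_root.
apply/IH/lev.
by rewrite yE -iterD addnS -addSn addnC iterD nz iter_root.
Qed.

(** A node [y] of [S] in [TS e f S x] lies on the branch below [x], and any
other node of [TS e f S x] is either on that branch or above [x]; so [y] and [z]
are comparable, and comparable nodes of equal height coincide. *)
Lemma TS_level_eq (T : Type) (e : T) (f : T -> T) (S : set T) (x y z : T) :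
  is_tree e f -> is_subtree e f S -> S x ->
  TS e f S x y -> S y -> TS e f S x z ->
  (forall n, iter n f y = e <-> iter n f z = e) -> y = z.
Proof.
move=> tT tS Sx yT Sy zT lev.
suff [zy|yz] : extends f z y \/ extends f y z.
- by apply: extends_level_eq tT zy _ => n /lev.
- by apply/esym; apply: extends_level_eq tT yz _ => n /lev.
have [j yE] : exists j, y = iter j f x.
  have [/extendsP//|xy] := (TSP y tS Sx).1 yT.
  by exists 0; exact: attached_mem xy Sy.
have [/extendsP[k zE]|xz] := (TSP z tS Sx).1 zT; last first.
  have [k kz] := attached_iter xz.
  by left; apply/extendsP; exists (j + k); rewrite iterD kz.
have [jk|/ltnW kj] := leqP j k.
  by right; apply/extendsP; exists (k - j); rewrite yE zE -iterD subnK.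
by left; apply/extendsP; exists (j - k); rewrite yE zE -iterD subnK.
Qed.

(** The map that is [phi] on [A] and the identity on [S] is consistent because
[phi] preserves heights: a node of [A] that lies in [S], or is sent into [S],
must be fixed by [TS_level_eq]. The second case is what makes the combined map
injective. *)
Lemma sub_iso_TS_setU (T : Type) (e : T) (f : T -> T) (S A B : set T)
    (phi : T -> T) (x : T) :
  is_tree e f -> is_subtree e f S -> S x ->
  A `<=` TS e f S x -> B `<=` TS e f S x -> closed_under f A ->
  sub_iso f A B phi ->
  exists psi, [/\ sub_iso f (A `|` S) (B `|` S) psi,
    forall a, A a -> psi a = phi a & forall s, S s -> psi s = s].
Proof.
move=> tT tS Sx AT BT fA phiI.
have [[phiAB phi_inj phi_surj] phif] := phiI.
have phiT a : A a -> TS e f S x (phi a) by move=> /phiAB/BT.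
have phi_fix a : A a -> S a \/ S (phi a) -> phi a = a.
  move=> Aa [Sa|Sp].
    apply/esym; apply: (TS_level_eq tT tS Sx) => //; try by [exact: AT|exact: phiT].
    by move=> n; split=> /(sub_iso_level n tT fA phiI Aa).
  apply: (TS_level_eq tT tS Sx) => //; try by [exact: AT|exact: phiT].
  by move=> n; split=> /(sub_iso_level n tT fA phiI Aa).
pose psi y := if pselect (A y) then phi y else y.
have psiA a : A a -> psi a = phi a by rewrite /psi; case: pselect.
have psiS s : S s -> psi s = s.
  by rewrite /psi; case: pselect => // As Ss; apply: phi_fix => //; left.
have psi_mix a s : A a -> S s -> psi a = psi s -> a = s.
  move=> Aa Ss; rewrite psiA // psiS // => as_.
  by rewrite -as_ phi_fix //; right; rewrite as_.
exists psi; split=> //; split; first split.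
- by move=> y [Ay|Sy]; [left; rewrite psiA //; exact: phiAB|right; rewrite psiS].
- move=> y z; rewrite !inE => -[Ay|Sy] [Az|Sz].
  + by rewrite !psiA // => /phi_inj; apply; rewrite inE.
  + exact: psi_mix.
  + by move=> /esym/psi_mix ->.
  + by rewrite !psiS.
- move=> z [/phi_surj[y Ay <-]|Sz]; last by exists z; [right|exact: psiS].
  by exists y; [left|exact: psiA].
- move=> y [Ay|Sy]; first by rewrite !psiA ?phif //; exact: fA.
  by rewrite !psiS //; exact: tS.2.
Qed.

(** * From weak ultrahomogeneity to the pieces *)

Lemma automorphism_inv (T : Type) (f g h : T -> T) :
  automorphism f g -> cancel g h -> cancel h g -> automorphism f h.
Proof.
move=> [_ gf] gK hK; split; first by exists g.
by move=> a; apply: (can_inj gK); rewrite gf !hK.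
Qed.

Lemma automorphism_TS (T : Type) (e : T) (f : T -> T) (S : set T)
    (g : T -> T) (x y : T) :
  is_subtree e f S -> S x -> automorphism f g -> (forall s, S s -> g s = s) ->
  TS e f S x y -> TS e f S x (g y).
Proof.
move=> tS Sx [/bij_inj g_inj gf] gS /TSP; case=> // [xy|xy].
  rewrite gS; first by apply/TSP => //; left.
  by have /extendsP[n ->] := xy; exact: closed_under_iter tS.2 _.
apply: attached_TS => //.
apply: (@attached_morph _ _ _ setT) => //; first exact: gS.
by move=> a _ _ Sga; rewrite -(g_inj _ _ (gS _ Sga)).
Qed.

Lemma fg_substructureU (T : Type) (f : T -> T) (A B : set T) :
  fg_substructure f A -> fg_substructure f B -> fg_substructure f (A `|` B).
Proof.
move=> [finA fA] [finB fB]; split; first by rewrite finite_setU.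
by move=> a [/fA|/fB]; [left|right].
Qed.

Definition extend_id (T : Type) (D : set T) (phi : D -> D) (y : T) : T :=
  if insub y is Some u then val (phi u) else y.

Lemma extend_idE (T : Type) (D : set T) (phi : D -> D) (u : D) :
  extend_id phi (val u) = val (phi u).
Proof. by rewrite /extend_id valK. Qed.

Lemma fg_substructure_val (T : Type) (f : T -> T) (D : set T)
    (fD : closed_under f D) (A : set D) :
  fg_substructure (restr_fun fD) A -> fg_substructure f (val @` A).
Proof.
move=> [finA fA]; split; first exact: finite_image.
by move=> _ [u Au <-]; exists (restr_fun fD u) => //; exact: fA.
Qed.

Lemma sub_iso_val (T : Type) (f : T -> T) (D : set T)
    (fD : closed_under f D) (A B : set D) (phi : D -> D) :
  sub_iso (restr_fun fD) A B phi ->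
  sub_iso f (val @` A) (val @` B) (extend_id phi).
Proof.
move=> [[phiAB phi_inj phi_surj] phif]; split; first split.
- by move=> _ [u Au <-]; rewrite extend_idE; exists (phi u) => //; exact: phiAB.
- move=> y z; rewrite !inE => -[u Au <-] [v Av <-].
  by rewrite !extend_idE => /val_inj/phi_inj->//; rewrite inE.
- move=> _ [v /phi_surj[u Au <-] <-].
  by exists (val u); [exists u|rewrite extend_idE].
- move=> _ [u Au <-]; rewrite extend_idE.
  have -> : f (val u) = val (restr_fun fD u) by [].
  by rewrite extend_idE phif.
Qed.

Lemma automorphism_restr (T : Type) (f g : T -> T) (D : set T)
    (fD : closed_under f D) :
  (forall y, D (g y) <-> D y) -> automorphism f g ->
  exists2 h, automorphism (restr_fun fD) h & forall u, val (h u) = g (val u).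
Proof.
move=> gD [[k gK kK] gf].
have gu (u : D) : g (val u) \in D by apply/mem_set/gD/set_mem; exact: valP.
have ku (u : D) : k (val u) \in D.
  by apply/mem_set/gD; rewrite kK; apply: set_mem; exact: valP.
exists (fun u => SigSub (gu u)) => //; split.
  exists (fun u => SigSub (ku u)) => u; apply: val_inj => /=.
    by rewrite gK.
  by rewrite kK.
by move=> u; apply: val_inj; rewrite /= gf.
Qed.

(** The orbit is constant from the first visit of the root on. *)
Lemma finite_orbit (T : Type) (e : T) (f : T -> T) (a : T) :
  is_tree e f -> finite_set [set iter n f a | n in setT].
Proof.
move=> tT; have [N Na] := tree_reach tT a.
apply: (@sub_finite_set _ _ [set iter n f a | n in `I_N.+1]).
  move=> _ [n _ <-]; have [nN|Nn] := ltnP n N.+1; first by exists n.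
  exists N => //=; rewrite -(subnK (ltnW Nn)) iterD Na.
  by rewrite iter_root.
exact/finite_image/finite_II.
Qed.

Lemma finite_subtree_hull (T : Type) (e : T) (f : T -> T) (F : set T) :
  is_tree e f -> finite_set F ->
  exists S, [/\ finite_set S, is_subtree e f S & F `<=` S].
Proof.
move=> tT finF.
exists (\bigcup_(a in e |` F) [set iter n f a | n in setT]); split.
- apply: bigcup_finite; first by rewrite finite_setU; split.
  by move=> a _; exact: finite_orbit tT.
- split; first by exists e; [left|exists 0].
  by move=> _ [a Fa [n _ <-]]; exists a => //; exists n.+1.
- by move=> a Fa; exists a; [right|exists 0].
Qed.

Lemma weakly_ultrahomogeneous_TS (T : Type) (e : T) (f : T -> T) :
  is_tree e f -> weakly_ultrahomogeneous f ->
  exists S : set T, [/\ finite_set S, is_subtree e f S &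
    forall x : T, S x -> ultrahomogeneous (@TS_pred T e f S x)].
Proof.
move=> tT [F finF wu].
have [S [finS tS FS]] := finite_subtree_hull tT finF.
exists S; split=> // x Sx A B phi fgA fgB phiI.
have fgA' := fg_substructure_val fgA.
have fgB' := fg_substructure_val fgB.
have subT (C : set (TS e f S x)) : val @` C `<=` TS e f S x.
  by move=> _ [u _ <-]; apply: set_mem; exact: valP.
have [psi [psiI psiA psiS]] := sub_iso_TS_setU tT tS Sx (subT A) (subT B)
  fgA'.2 (sub_iso_val phiI).
have fgS : fg_substructure f S by split; last exact: tS.2.
have [||a /FS/psiS//|g gaut gE] := wu _ _ _ (fg_substructureU fgA' fgS)
  (fg_substructureU fgB' fgS) _ _ psiI; [by move=> a /FS; right..|].
have gS s : S s -> g s = s by move=> Ss; rewrite gE ?psiS //; right.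
have gT y : TS e f S x (g y) <-> TS e f S x y.
  split; last exact: automorphism_TS.
  have [k gK kK] := gaut.1; rewrite -{2}(gK y).
  apply: automorphism_TS => //; first exact: automorphism_inv gaut gK kK.
  by move=> s Ss; rewrite -{1}(gS s Ss) gK.
have [h haut hE] := automorphism_restr (@TS_closed T e f S x) gT gaut.
exists h => // u Au; apply: val_inj; rewrite hE gE; last by left; exists u.
by rewrite psiA ?extend_idE //; exists u.
Qed.

(** * From the pieces to weak ultrahomogeneity *)

Lemma sub_iso_restr (T : Type) (f : T -> T) (D : set T)
    (fD : closed_under f D) (A B : set T) (phi : T -> T) :
  closed_under f A ->
  (forall a, A a -> D (phi a) <-> D a) -> sub_iso f A B phi ->
  exists2 psi : D -> D,
    sub_iso (restr_fun fD) (val @^-1` A) (val @^-1` B) psi &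
    forall u, A (val u) -> val (psi u) = phi (val u).
Proof.
move=> fA phiD [[phiAB phi_inj phi_surj] phif].
(* Outside [A], [phi (val u)] may leave [D]; [u] is the default value then. *)
pose psi (u : D) : D := insubd u (phi (val u)).
have psiE u : A (val u) -> val (psi u) = phi (val u).
  move=> Au; rewrite val_insubd mem_set //; apply/phiD => //.
  by apply: set_mem; exact: valP.
exists psi => //; split; first split.
- by move=> u /= Au; rewrite psiE //; exact: phiAB.
- move=> u v; rewrite !inE /= => Au Av /(congr1 val).
  by rewrite !psiE // => /phi_inj uv; apply: val_inj; apply: uv; rewrite inE.
- move=> v /= /phi_surj[a Aa av].
  have Da : a \in D.
    by apply/mem_set/phiD => //; rewrite av; apply: set_mem; exact: valP.
  by exists (SigSub Da) => //; apply: val_inj; rewrite psiE.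
- move=> u /= Au; apply: val_inj; rewrite psiE //=; last exact: fA.
  by rewrite psiE // phif.
Qed.

Lemma fg_substructure_preimage (T : Type) (f : T -> T) (D : set T)
    (fD : closed_under f D) (A : set T) :
  fg_substructure f A ->
  fg_substructure (restr_fun fD) (val @^-1` A : set D).
Proof.
move=> [finA fA]; split; last by move=> u /= /fA.
by apply: finite_preimage => // u v _ _; exact: val_inj.
Qed.

(** An injective map fixing [S] sends no node outside [S] into [S], so
[attached_morph] makes [phi] preserve the fibres. It reflects them as well,
since the fibre containing [a] also contains [phi a] and fibres are
disjoint. *)
Lemma sub_iso_TS (T : Type) (e : T) (f : T -> T) (S A B : set T)
    (phi : T -> T) (x a : T) :
  is_tree e f -> is_subtree e f S -> S `<=` A -> closed_under f A ->
  sub_iso f A B phi -> (forall s, S s -> phi s = s) -> S x -> A a ->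
  TS e f S x (phi a) <-> TS e f S x a.
Proof.
move=> tT tS SA fA [[_ phi_inj _] phif] phiS Sx Aa.
have phi_mem b : A b -> S (phi b) -> S b.
  move=> Ab Spb; rewrite -(phi_inj _ _ _ _ (phiS _ Spb)) ?inE //.
  exact: SA.
have [Sa|nSa] := pselect (S a); first by rewrite phiS.
have nSpa : ~ S (phi a) by move=> /phi_mem-/(_ Aa).
have phi_att x' : S x' -> attached f S x' a -> attached f S x' (phi a).
  move=> Sx'; apply: (@attached_morph _ _ _ A) => //.
  - by move=> b Ab _ _; exact: phif.
  - exact: phiS.
  - by move=> b Ab _; exact: phi_mem.
have TS_att y : ~ S y -> TS e f S x y -> attached f S x y.
  move=> nSy /TSP-/(_ tS Sx)[/extendsP[n yE]|//].
  by case: nSy; rewrite yE; exact: closed_under_iter tS.2 _.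
split=> /TS_att xa; apply: attached_TS => //; last exact/phi_att/xa.
have [x' Sx' x'a] := attached_exists a tT tS.
rewrite (attached_inj Sx Sx' (xa nSpa) _) //; exact: phi_att.
Qed.

Lemma TS_extension (T : Type) (e : T) (f : T -> T) (S A B : set T)
    (phi : T -> T) (x : T) :
  is_tree e f -> is_subtree e f S -> S `<=` A ->
  fg_substructure f A -> fg_substructure f B ->
  sub_iso f A B phi -> (forall s, S s -> phi s = s) -> S x ->
  ultrahomogeneous (@TS_pred T e f S x) ->
  exists h, sub_iso f (TS e f S x) (TS e f S x) h /\
    forall a, A a -> TS e f S x a -> h a = phi a.
Proof.
move=> tT tS SA fgA fgB phiI phiS Sx uT.
have phiT a : A a -> TS e f S x (phi a) <-> TS e f S x a.
  exact: sub_iso_TS tT tS SA fgA.2 phiI phiS Sx.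
have [psi psiI psiE] := sub_iso_restr (@TS_closed T e f S x) fgA.2 phiT phiI.
have [g [[k gK kK] gf] gE] := uT _ _ _
  (fg_substructure_preimage _ fgA) (fg_substructure_preimage _ fgB) psiI.
have gI : sub_iso (@TS_pred T e f S x) setT setT g.
  split; last by move=> u _; exact: gf.
  split=> //; first by move=> u v _ _; exact: can_inj gK _ _.
  by move=> v _; exists (k v).
exists (extend_id g); split.
  have := sub_iso_val gI; suff -> : val @` [set: TS e f S x] = TS e f S x by [].
  apply/seteqP; split=> [_ [u _ <-]|y yT]; first by apply: set_mem; exact: valP.
  by exists (SigSub (mem_set yT)).
move=> a Aa /mem_set aT; have := extend_idE g (SigSub aT) => /= ->.
by rewrite gE //= psiE.
Qed.

(** Each node is moved by the map of the fibre containing it. Every [h x]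
permutes the fibre over [x], because it permutes [TS e f S x] and fixes the
rest of it, the branch below [x]; as the fibres partition [T], the result is a
bijection. It commutes with [f] even where [f] leaves a fibre, as this happens
only at nodes of [S]. *)
Lemma glue_automorphism (T : Type) (e : T) (f : T -> T) (S : set T)
    (h : T -> T -> T) :
  is_tree e f -> is_subtree e f S ->
  (forall x, S x -> sub_iso f (TS e f S x) (TS e f S x) (h x)) ->
  (forall x s, S x -> S s -> TS e f S x s -> h x s = s) ->
  exists2 g, automorphism f g &
    forall x y, S x -> attached f S x y -> g y = h x y.
Proof.
move=> tT tS hI hS.
have p_ex y : exists x, S x /\ attached f S x y.
  by have [x] := attached_exists y tT tS; exists x.
have [p pP] := choice p_ex.
have pE x y : S x -> attached f S x y -> p y = x.
  by move=> Sx xy; have [Sp py] := pP y; exact: attached_inj Sp Sx py xy.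
have attT x y := @attached_TS T e f S x y tS.
have h_att x y : S x -> attached f S x y -> attached f S x (h x y).
  move=> Sx xy; have [[hT h_inj _] hf] := hI _ Sx.
  apply: (@attached_morph _ _ _ setT) => //.
  - by move=> a _ xa _; apply/hf/attT.
  - by apply: hS => //; apply: attT => //; exact: attached_base.
  - move=> a _ xa Sha; have aT := attT _ _ Sx xa.
    have haT := hT _ aT.
    by rewrite -(h_inj _ _ _ _ (hS _ _ Sx Sha haT)) ?inE.
pose g y := h (p y) y.
have gE x y : S x -> attached f S x y -> g y = h x y.
  by move=> Sx xy; rewrite /g (pE x).
have gS s : S s -> g s = s.
  by move=> Ss; rewrite (gE s) //; [apply: hS => //; apply: attT => //|];
     exact: attached_base.
exists g => //; split.
  rewrite -setTT_bijective; split=> //.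
    move=> y z _ _ yz; have [Sy py] := pP y; have [Sz pz] := pP z.
    have pyz : p y = p z.
      rewrite -(pE _ _ Sy (h_att _ _ Sy py)) -(pE _ _ Sz (h_att _ _ Sz pz)).
      by congr p.
    move: yz; rewrite /g -pyz in pz *; have [[_ h_inj _] _] := hI _ Sy.
    by apply: h_inj; rewrite inE; exact: attT.
  move=> z _; have [Sz pz] := pP z.
  have [[_ _ h_surj] _] := hI _ Sz.
  have [y yT hy] := h_surj _ (attT _ _ Sz pz).
  have [Sy|nSy] := pselect (S y).
    by exists y => //; rewrite gS // -hy hS.
  exists y => //; rewrite -hy; apply: gE => //.
  move/TSP: yT => /(_ tS Sz)[/extendsP[n yE]|//].
  by case: nSy; rewrite yE; exact: closed_under_iter tS.2 _.
move=> y; have [Sy|nSy] := pselect (S y).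
  by rewrite !gS //; exact: tS.2.
have [Sp py] := pP y; rewrite (gE (p y)) //; last exact: attached_fun.
by rewrite (hI _ Sp).2 //; exact: attT.
Qed.

Lemma TS_weakly_ultrahomogeneous (T : Type) (e : T) (f : T -> T) (S : set T) :
  is_tree e f -> finite_set S -> is_subtree e f S ->
  (forall x : T, S x -> ultrahomogeneous (@TS_pred T e f S x)) ->
  weakly_ultrahomogeneous f.
Proof.
move=> tT finS tS uT; exists S => // A B phi fgA fgB SA _ phiI phiS.
have h_ex x : exists hx, S x -> sub_iso f (TS e f S x) (TS e f S x) hx /\
    forall a, A a -> TS e f S x a -> hx a = phi a.
  have [Sx|nSx] := pselect (S x); last by exists id.
  have [hx hxP] := TS_extension tT tS SA fgA fgB phiI phiS Sx (uT x Sx).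
  by exists hx.
have [h hP] := choice h_ex.
have [|x s Sx Ss sT|g gaut gE] := glue_automorphism (h := h) tT tS.
- by move=> x /hP[].
- by rewrite (hP _ Sx).2 ?phiS //; exact: SA.
exists g => // a Aa; have [x Sx xa] := attached_exists a tT tS.
by rewrite (gE x) // (hP _ Sx).2 //; exact: attached_TS.
Qed.

Theorem theorem7p11 (T : Type) (e : T) (f : T -> T) :
  is_tree e f -> countable [set: T] ->
  weakly_ultrahomogeneous f <->
  exists S : set T, [/\ finite_set S, is_subtree e f S &
    forall x : T, S x -> ultrahomogeneous (@TS_pred T e f S x)].
Proof.
move=> tT _; split; first exact: weakly_ultrahomogeneous_TS.
by move=> [S [finS tS uT]]; exact: TS_weakly_ultrahomogeneous tT finS tS uT.
Qed.
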